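(* Let $(X,d)$ be a nonempty separable metric space in which all balls $D(x,r):=\{y: d(x,y)<r\}$ are relatively compact, let $\mu$ be a positive Radon measure on $X$ with full support, and let $(x,y,t)\mapsto p_t(x,y)\in[0,\infty)$ be a continuous function on $X\times X\times(0,\infty)$ such that: (CK) $p_{s+t}(x,y)=\int p_s(x,z)p_t(z,y)\,d\mu(z)$ for all $s,t>0$, $x,y\in X$; (E) $\sup_{t>0}\int p_t(x,y)\,d\mu(y)=1$ for every $x\in X$; (B) there are constants $\alpha,\beta>0$ and decreasing functions $\Phi_1,\Phi_2\colon[0,\infty)\to[0,\infty)$ with $\Phi_1(1)>0$, $\int_0^\infty\sigma^{\alpha-1}\Phi_2(\sigma)\,d\sigma<\infty$ and $$t^{-\alpha/\beta}\Phi_1\big(d(x,y)t^{-1/\beta}\big)\le p_t(x,y)\le t^{-\alpha/\beta}\Phi_2\big(d(x,y)t^{-1/\beta}\big)\quad\text{for all }x,y\in X,\ t>0.$$ Assume $\beta<\alpha$ and let $G(x,y):=\int_0^\infty p_t(x,y)\,dt$, $x,y\in X$. Let $A$ be a subset of $X$. 1. If $m_{\alpha-\beta}(A)<\infty$, then $A$ is contained in a $G$-semipolar Borel set. 2. If $m_{\alpha-\beta}(A)=0$, then $A$ is contained in a $G$-polar Borel set.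
   Context: $m_{\alpha-\beta}(A):=\lim_{\delta\to0}\inf\{\sum_{j=1}^\infty\rho_j^{\alpha-\beta}: A\subset\bigcup_{j=1}^\infty D(x_j,\rho_j),\ x_j\in X,\ 0<\rho_j<\delta\}$ for $A\subset X$. For a positive Radon measure $\nu$ on $X$, $G\nu(x):=\int G(x,y)\,d\nu(y)$. A Borel set $A\subset X$ is $G$-semipolar (respectively $G$-polar) if there is no positive Radon measure $\nu\ne0$ on $X$ such that $\nu(X\setminus A)=0$ and $G\nu$ is continuous and real (respectively, $G\nu$ is bounded). *)

(* Defs.v *)
From HB Require Import structures.
From mathcomp Require Import all_boot all_order all_algebra.
From mathcomp Require Import all_classical all_reals all_analysis.

Set Implicit Arguments.
Unset Strict Implicit.
Unset Printing Implicit Defensive.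

Import Order.TTheory GRing.Theory Num.Theory.
Import numFieldNormedType.Exports.

Local Open Scope classical_set_scope.
Local Open Scope ring_scope.

(* Nonempty metric spaces: measurable types must be pointed, whereas
   [metricType] is not. *)
#[short(type="metricPType")]
HB.structure Definition PMetric (K : numDomainType) :=
  { M of Metric K M & Pointed M }.

(* [X] with its Borel sigma-algebra; convertible to [X]. *)
Notation borel X := (g_sigma_algebraType (@open X)).

Section defs.
Context {R : realType} {X : metricPType R}.

Definition separable_space := exists2 S : set X, countable S & dense S.

(* Finite on compact sets and inner regular. When balls are relatively compact
   and the space is separable, the second clause follows from the first. *)
Definition radon (mu : {measure set (borel X) -> \bar R}) :=
  (forall K : set X, compact K -> (mu K < +oo)%E) /\
  (forall B : set (borel X), measurable B ->
    mu B = ereal_sup [set mu K | K in [set K : set X | compact K /\ K `<=` B]]).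

Definition full_support (mu : {measure set (borel X) -> \bar R}) :=
  forall U : set X, open U -> U !=set0 -> (0 < mu U)%E.

Definition ball_content (s delta : R) (A : set X) : \bar R :=
  ereal_inf [set v | exists (x : nat -> X) (rho : nat -> R),
    [/\ (forall j, 0 < rho j < delta),
        A `<=` \bigcup_j ball (x j) (rho j) &
        v = (\sum_(0 <= j <oo) (rho j `^ s)%:E)%E]].

Definition hausdorff_ball_measure (s : R) (A : set X) : \bar R :=
  lim (ball_content s delta A @[delta --> 0^'+]).

Definition green (p : R -> X -> X -> R) (x y : X) : \bar R :=
  (\int[lebesgue_measure]_(t in `]0%R, +oo[) (p t x y)%:E)%E.

Definition potential (G : X -> X -> \bar R)
    (nu : {measure set (borel X) -> \bar R}) (x : X) : \bar R :=
  (\int[nu]_y G x y)%E.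

Definition semipolar (G : X -> X -> \bar R) (B : set (borel X)) :=
  measurable B /\
  ~ exists nu : {measure set (borel X) -> \bar R},
    [/\ radon nu, nu setT != 0%E, nu (~` B) = 0%E &
        exists2 g : X -> R, continuous g &
          forall x, potential G nu x = (g x)%:E].

Definition polar (G : X -> X -> \bar R) (B : set (borel X)) :=
  measurable B /\
  ~ exists nu : {measure set (borel X) -> \bar R},
    [/\ radon nu, nu setT != 0%E, nu (~` B) = 0%E &
        exists c : R, forall x, (potential G nu x <= c%:E)%E].

End defs.

Arguments separable_space {R} X.

(* Main.v *)
Require Import Defs.
From HB Require Import structures.
From mathcomp Require Import all_boot all_order all_algebra.
From mathcomp Require Import all_classical all_reals all_analysis.
From mathcomp Require Import measurable_realfun lra.

Set Implicit Arguments.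
Unset Strict Implicit.
Unset Printing Implicit Defensive.

Import Order.TTheory GRing.Theory Num.Theory.
Import numFieldNormedType.Exports.

Local Open Scope classical_set_scope.
Local Open Scope ring_scope.

(** By the lower bound on [p], integrating over times in [r^beta, 2 r^beta]
    alone gives [G(x, y) >= c r^(beta - alpha)] when [d(x, y) < r], so
    [nu(D(x, r)) <= c^-1 r^(alpha - beta) * G_I nu(x)], where [G_I] restricts
    the time integral to any [I] containing [r^beta, 2 r^beta].  If [G nu] is
    bounded, covers with [sum_j rho_j^(alpha - beta)] arbitrarily small show
    that [nu] vanishes on the intersection of the covers.  If [G nu] is
    continuous, Fatou's lemma makes the potentials over times [t >= 1/n] lower
    semicontinuous, and they increase to [G nu]; by Dini, the potentials over
    times [t < 1/n] tend to [0] uniformly on compact sets.  Hence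
    [nu(D(x, r)) = o(r^(alpha - beta))] locally uniformly in [x], and covers
    with bounded sums and radii tending to [0] again give a null set. *)

(** * Sequential lower semicontinuity and Fatou's lemma *)

Section sequential_lsc.
Context {R : realType} {X : metricPType R}.

(** Lower semicontinuity is stated along sequences so that Fatou's lemma applies to it directly; in
    a metric space this is the topological notion. *)
Definition seq_lsc (f : X -> \bar R) :=
  forall (u : nat -> X) x, u @ \oo --> x -> (f x <= limn_einf (f \o u))%E.

Lemma continuous_seq_lsc (f : X -> R) :
  continuous f -> seq_lsc (fun x => (f x)%:E).
Proof.
move=> cf u x ux.
have /cvg_limn_einf_sup[-> _] // : (fun n => (f (u n))%:E) @ \oo --> (f x)%:E.
by apply: cvg_EFin; [exact: nearW|exact: (continuous_cvg _ (cf x) ux)].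
Qed.

(** If the superlevel set were not a neighbourhood of [x], each ball of radius [n.+1%:R^-1] would
    contain a point with value at most [a]. These points tend to [x] and their lower limit is at
    most [a]. *)
Lemma seq_lsc_open (f : X -> \bar R) (a : R) :
  seq_lsc f -> open [set x | (a%:E < f x)%E].
Proof.
move=> lf; rewrite openE => x /= afx; apply: contrapT => nx.
have bad n : exists y, ball x n.+1%:R^-1 y /\ (f y <= a%:E)%E.
  apply: contrapT => /forallNP hn; apply: nx.
  apply: (filterS _ (nbhsx_ballx x n.+1%:R^-1 _)); last by rewrite invr_gt0.
  by move=> y xy /=; rewrite ltNge; apply/negP => fya; exact: (hn y).
have [u /all_and2[xu fua]] := choice bad.
have ux : u @ \oo --> x.
  apply/cvg_ballP => e e0; near=> n.
  apply: (le_ball _ (xu n)); apply/ltW.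
  by near: n; exact: (near_infty_natSinv_lt (PosNum e0)).
have := lf _ _ ux; rewrite leNgt => /negP; apply.
apply: le_lt_trans afx; rewrite limn_einf_lim.
apply: lime_le; first exact: is_cvg_einfs.
apply: nearW => n; apply: le_trans (fua n).
by apply: ereal_inf_lbound; exists n => /=.
Unshelve. all: by end_near. Qed.

Lemma seq_lsc_measurable (f : X -> \bar R) :
  seq_lsc f -> measurable_fun setT (f : borel X -> \bar R).
Proof.
move=> lf; apply: (measurability _ (ErealGenOInfty.measurableE R)).
move=> /= _ [_ [a ->]] <-; rewrite setTI preimage_itvoy.
by apply: sub_sigma_algebra; exact: seq_lsc_open.
Qed.

Lemma seq_lsc_integral d (T : measurableType d) (m : {measure set T -> \bar R})
    (D : set T) (f : X -> T -> \bar R) :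
  measurable D -> (forall x, measurable_fun D (f x)) ->
  (forall x s, D s -> (0 <= f x s)%E) -> (forall s, D s -> seq_lsc (f^~ s)) ->
  seq_lsc (fun x => \int[m]_(s in D) f x s)%E.
Proof.
move=> mD mf f0 lf u x ux.
apply: le_trans (fatou m mD (fun n => mf (u n)) (fun n s => f0 (u n) s)).
apply: ge0_le_integral => //.
- exact: f0.
- apply: measurableT_comp => //.
  apply: measurable_fun_limn_esup => n.
  exact: measurableT_comp.
- by move=> s Ds; exact: (lf s Ds).
Qed.

End sequential_lsc.

(** * Balls as open and measurable sets *)

Section metric_balls.
Context {R : realType} {X : metricPType R}.

Lemma open_metric_ball (x : X) (r : R) : open (ball x r).
Proof.
rewrite openE => y; rewrite ballEmdist /= => xy.
have yr : 0 < r - mdist x y by rewrite subr_gt0.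
apply/nbhs_ballP; exists (r - mdist x y) => // z /=.
rewrite !ballEmdist /= => yz; apply: le_lt_trans (metric_triangle x y z) _.
by rewrite -ltrBrDl.
Qed.

Lemma measurable_metric_ball (x : X) (r : R) :
  measurable (ball x r : set (borel X)).
Proof. by apply: sub_sigma_algebra; exact: open_metric_ball. Qed.

Lemma bigcup_metric_ball (x : X) : \bigcup_n ball x n%:R = setT.
Proof.
apply/seteqP; split => // y _; have := archi_boundP (mdist_ge0 x y).
by move=> h; exists (Num.bound (mdist x y)) => //; rewrite ballEmdist.
Qed.

End metric_balls.

(** * Borel hulls and covers from the Hausdorff measure *)

Section hausdorff_content.
Context {R : realType} {X : metricPType R}.

(** A smaller [delta] admits fewer covers, so the content is nonincreasing in [delta] and its limit
    at [0] from the right is a supremum. *)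
Lemma ball_content_le_hausdorff (s delta : R) (A : set X) : 0 < delta ->
  (ball_content s delta A <= hausdorff_ball_measure s A)%E.
Proof.
move=> d0; have mono : {in `]0, +oo[ &, {homo ball_content s ^~ A :
    n m / n <= m >-> (m <= n)%E}}.
  move=> e1 e2 _ _ e12; apply: ereal_inf_le_tmp => v [x [rho [h1 h2 ->]]].
  exists x, rho; split=> // j; have /andP[-> h] := h1 j.
  exact: lt_le_trans h e12.
have /cvg_lim := nonincreasing_at_right_cvge +oo%O isT mono.
rewrite /hausdorff_ball_measure => -> //.
by apply: ereal_sup_ubound; exists delta => //=; rewrite in_itv /= d0.
Qed.

(** Choose a cover of [A] for each scale and intersect their unions: the result is a G-delta set
    that all the chosen covers still cover. The bound [M] varies with the scale so that it can be
    constant for semipolarity and tend to [0] for polarity. *)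
Lemma hausdorff_hull (s : R) (A : set X) (M : nat -> \bar R) :
  (forall n, (hausdorff_ball_measure s A < M n)%E) ->
  exists2 S : set (borel X), A `<=` S & measurable S /\
    forall n, exists (x : nat -> X) (rho : nat -> R),
      [/\ (forall j, 0 < rho j < n.+1%:R^-1),
          S `<=` \bigcup_j ball (x j) (rho j) &
          (\sum_(0 <= j <oo) (rho j `^ s)%:E < M n)%E].
Proof.
move=> HM; have cover n : exists xr : (nat -> X) * (nat -> R),
    [/\ (forall j, 0 < xr.2 j < n.+1%:R^-1),
        A `<=` \bigcup_j ball (xr.1 j) (xr.2 j) &
        (\sum_(0 <= j <oo) (xr.2 j `^ s)%:E < M n)%E].
  have n0 : (0 : R) < n.+1%:R^-1 by rewrite invr_gt0.
  have := le_lt_trans (ball_content_le_hausdorff s A n0) (HM n).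
  move=> /ereal_inf_lt[_ [x [rho [h1 h2 ->]]] h3].
  by exists (x, rho).
have [xr xrP] := choice cover.
exists (\bigcap_n \bigcup_j ball ((xr n).1 j) ((xr n).2 j)).
  by move=> y Ay n _; have [_ h _] := xrP n; exact: h.
split.
  apply: bigcapT_measurable => n; apply: bigcupT_measurable => j.
  exact: measurable_metric_ball.
move=> n; have [h1 _ h3] := xrP n; exists (xr n).1, (xr n).2; split => //.
by move=> y; exact.
Qed.

(** The set [B] localises the estimate: a fixed ball in the semipolar case, the whole space in the
    polar case. *)
Lemma cover_measure_le (nu : {measure set (borel X) -> \bar R})
    (S B : set (borel X)) (x : nat -> X) (rho : nat -> R) (s k : R) :
  measurable S -> measurable B -> 0 <= k ->
  S `<=` \bigcup_j ball (x j) (rho j) ->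
  (forall j, (nu (ball (x j) (rho j) `&` B) <= (k * rho j `^ s)%:E)%E) ->
  (nu (S `&` B) <= k%:E * \sum_(0 <= j <oo) (rho j `^ s)%:E)%E.
Proof.
move=> mS mB k0 Scov hj.
apply: (@le_trans _ _ (\sum_(0 <= j <oo) nu (ball (x j) (rho j) `&` B))%E).
  apply: measure_sigma_subadditive.
  - by move=> j; apply: measurableI => //; exact: measurable_metric_ball.
  - exact: measurableI.
  - by rewrite -setI_bigcupl; exact: setSI.
rewrite -nneseriesZl; last by move=> j _; rewrite lee_fin powR_ge0.
by apply: lee_nneseries => // j _; rewrite -EFinM.
Qed.

End hausdorff_content.

(** * Splitting the time axis at a small positive time *)

Section time_split.
Context {R : realType}.

Definition early_times (n : nat) : set R := `]0, n.+1%:R^-1[.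
Definition late_times (n : nat) : set R := `[n.+1%:R^-1, +oo[.

Lemma early_times_gt0 n : early_times n `<=` `]0, +oo[.
Proof. by move=> t; rewrite /early_times /= !in_itv /= => /andP[->]. Qed.

Lemma late_times_gt0 n : late_times n `<=` `]0, +oo[.
Proof.
move=> t; rewrite /late_times /= !in_itv /= !andbT; apply: lt_le_trans.
by rewrite invr_gt0.
Qed.

Lemma late_times_homo : {homo late_times : n m / (n <= m)%N >-> (n <= m)%O}.
Proof.
move=> n m nm; apply/subsetPset => t; rewrite /late_times /= !in_itv /= !andbT.
by apply: le_trans; rewrite lef_pV2 ?posrE// ler_nat.
Qed.

Lemma bigcup_late_times : \bigcup_n late_times n = `]0, +oo[%classic.
Proof.
apply/seteqP; split => [t [n _] /late_times_gt0 //|t].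
rewrite /= in_itv /= andbT => t0.
have [n _ /(_ n (leqnn n)) hn] := near_infty_natSinv_lt (PosNum t0).
by exists n => //; rewrite /late_times /= in_itv /= andbT ltW.
Qed.

Lemma measurable_early_times n : measurable (early_times n).
Proof. exact: measurable_itv. Qed.

Lemma measurable_late_times n : measurable (late_times n).
Proof. exact: measurable_itv. Qed.

End time_split.

#[local] Hint Resolve early_times_gt0 late_times_gt0 : core.


(** * Green functions and potentials restricted to a set of times *)

Section time_restricted_green.
Context {R : realType} {X : metricPType R}.
Context (p : R -> X -> X -> R).
Context (p_ge0 : forall t x y, 0 < t -> 0 <= p t x y).
Context (p_continuous : {within [set z : X * X * R | 0 < z.2],
  continuous (fun z : X * X * R => p z.2 z.1.1 z.1.2)}).

(** For [I] equal to []0, +oo[] this is [green p] by conversion. *)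
Definition time_green (I : set R) (x y : X) : \bar R :=
  (\int[lebesgue_measure]_(t in I) (p t x y)%:E)%E.

Lemma kernel_cvg (x y : X) (t : R) : 0 < t ->
  p z.2 z.1.1 z.1.2 @[z --> (x, y, t)] --> p t x y.
Proof.
move=> t0; move: p_continuous; rewrite continuous_open_subspace.
  by move=> /(_ (x, y, t)); rewrite inE; exact.
apply: (@open_comp _ _ (fun z : X * X * R => z.2) [set r | 0 < r]).
  by move=> z _; exact: cvg_snd.
exact: open_gt.
Qed.

Lemma kernel_continuous1 (t : R) (y : X) : 0 < t ->
  continuous (fun x => p t x y).
Proof.
move=> t0 x; have h : (x', y, t) @[x' --> x] --> (x, y, t).
  apply: (@cvg_pair _ _ _ (nbhs x) (nbhs (x, y)) (nbhs t)); last exact: cvg_cst.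
  by apply: (@cvg_pair _ _ _ (nbhs x) (nbhs x) (nbhs y));
    [exact: cvg_id|exact: cvg_cst].
exact: (cvg_comp _ _ h (kernel_cvg t0)).
Qed.

Lemma kernel_continuous2 (t : R) (x : X) : 0 < t -> continuous (p t x).
Proof.
move=> t0 y; have h : (x, y', t) @[y' --> y] --> (x, y, t).
  apply: (@cvg_pair _ _ _ (nbhs y) (nbhs (x, y)) (nbhs t)); last exact: cvg_cst.
  by apply: (@cvg_pair _ _ _ (nbhs y) (nbhs x) (nbhs y));
    [exact: cvg_cst|exact: cvg_id].
exact: (cvg_comp _ _ h (kernel_cvg t0)).
Qed.

Lemma kernel_measurable_time (I : set R) (x y : X) :
  measurable I -> I `<=` `]0, +oo[ ->
  measurable_fun I (fun t => (p t x y)%:E).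
Proof.
move=> mI I0; apply: (measurable_funS _ I0) => //.
apply/measurable_EFinP; apply: open_continuous_measurable_fun.
  exact: interval_open.
move=> t; rewrite inE /= in_itv /= andbT => t0.
have h : (x, y, t') @[t' --> t] --> (x, y, t).
  by apply: (@cvg_pair _ _ _ (nbhs t) (nbhs (x, y)) (nbhs t));
    [exact: cvg_cst|exact: cvg_id].
exact: (cvg_comp _ _ h (kernel_cvg t0)).
Qed.

Section time_set.
Context (I : set R) (mI : measurable I) (I0 : I `<=` `]0, +oo[).

Let I_gt0 t : I t -> 0 < t.
Proof. by move=> /I0 /=; rewrite in_itv /= andbT. Qed.

Lemma time_green_ge0 x y : (0 <= time_green I x y)%E.
Proof. by apply: integral_ge0 => t /I_gt0 t0; rewrite lee_fin p_ge0. Qed.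

Lemma time_green_seq_lsc1 y : seq_lsc (time_green I ^~ y).
Proof.
apply: seq_lsc_integral => //.
- by move=> x; exact: kernel_measurable_time.
- by move=> x t /I_gt0 t0; rewrite lee_fin p_ge0.
- by move=> t /I_gt0 t0; apply: continuous_seq_lsc; exact: kernel_continuous1.
Qed.

Lemma time_green_seq_lsc2 x : seq_lsc (time_green I x).
Proof.
apply: seq_lsc_integral => //.
- by move=> y; exact: kernel_measurable_time.
- by move=> y t /I_gt0 t0; rewrite lee_fin p_ge0.
- by move=> t /I_gt0 t0; apply: continuous_seq_lsc; exact: kernel_continuous2.
Qed.

Lemma time_green_measurable x :
  measurable_fun setT (time_green I x : borel X -> \bar R).
Proof. by apply: seq_lsc_measurable; exact: time_green_seq_lsc2. Qed.

(** Fatou's lemma is used twice: in time, for the restricted Green function, and here in [nu]. *)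
Lemma potential_time_green_seq_lsc (nu : {measure set (borel X) -> \bar R}) :
  seq_lsc (potential (time_green I) nu).
Proof.
apply: seq_lsc_integral => //.
- exact: time_green_measurable.
- by move=> x y _; exact: time_green_ge0.
- by move=> y _; exact: time_green_seq_lsc1.
Qed.

End time_set.

Lemma green_split n x y :
  green p x y =
    (time_green (early_times n) x y + time_green (late_times n) x y)%E.
Proof.
have split0y : `]0, +oo[%classic = early_times n `|` late_times n :> set R.
  apply/seteqP; split => t; last by case;
    [exact: early_times_gt0|exact: late_times_gt0].
  rewrite /early_times /late_times /= !in_itv /= !andbT => ->.
  by have [//|] := ltP t n.+1%:R^-1; [left|right].
rewrite /green /time_green split0y ge0_integral_setU //.
- exact: measurable_early_times.
- exact: measurable_late_times.
- rewrite -split0y; apply: kernel_measurable_time => //.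
- by move=> t; rewrite -split0y /= in_itv /= andbT => t0; rewrite lee_fin p_ge0.
- rewrite disj_set2E; apply/eqP; apply/seteqP; split => // t [].
  by rewrite /early_times /late_times /= !in_itv /= andbT => /andP[_];
    rewrite ltNge => /negP.
Qed.

(** The late times increase to the whole half-line, so monotone convergence applies first in time
    and then in [nu]. *)
Lemma potential_late_cvg (nu : {measure set (borel X) -> \bar R}) x :
  potential (time_green (late_times n)) nu x @[n --> \oo] -->
  potential (green p) nu x.
Proof.
have cvg y : time_green (late_times n) x y @[n --> \oo] --> green p x y.
  rewrite /green -bigcup_late_times;
    apply: ge0_nondecreasing_set_cvg_integral => //.
  - exact: late_times_homo.
  - by move=> n; exact: measurable_late_times.
  - by move=> n; apply: kernel_measurable_time => //;
      exact: measurable_late_times.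
  - move=> n t /late_times_gt0 /=; rewrite in_itv /= andbT => t0.
    by rewrite lee_fin p_ge0.
have -> : potential (green p) nu x =
    (\int[nu]_y limn (fun n => time_green (late_times n) x y))%E.
  by apply: eq_integral => y _; apply/esym/cvg_lim.
apply: cvg_monotone_convergence => //.
- by move=> n; apply: time_green_measurable => //; exact: measurable_late_times.
- by move=> n y _; apply: time_green_ge0 => //; exact: measurable_late_times.
- move=> y _ n m nm; apply: ge0_subset_integral => //.
  + exact: measurable_late_times.
  + exact: measurable_late_times.
  + by apply: kernel_measurable_time => //; exact: measurable_late_times.
  + by move=> t /late_times_gt0 /=; rewrite in_itv /= andbT => t0;
      rewrite lee_fin p_ge0.
  + exact/subsetPset/late_times_homo.
Qed.

Lemma potential_split (nu : {measure set (borel X) -> \bar R}) n x :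
  potential (green p) nu x =
  (potential (time_green (early_times n)) nu x +
   potential (time_green (late_times n)) nu x)%E.
Proof.
rewrite -ge0_integralD //.
- by apply: eq_integral => y _; exact: green_split.
- by move=> y _; apply: time_green_ge0.
- by apply: time_green_measurable => //; exact: measurable_early_times.
- by move=> y _; apply: time_green_ge0.
- by apply: time_green_measurable => //; exact: measurable_late_times.
Qed.

End time_restricted_green.

(** * Uniform smallness of early potentials *)

Section potential_continuity.
Context {R : realType} {X : metricPType R}.
Context (p : R -> X -> X -> R).
Context (p_ge0 : forall t x y, 0 < t -> 0 <= p t x y).
Context (p_continuous : {within [set z : X * X * R | 0 < z.2],
  continuous (fun z : X * X * R => p z.2 z.1.1 z.1.2)}).

(* Dini's argument: the late potentials are lower semicontinuous and increase
   to the continuous [g], so the early ones vanish locally uniformly. *)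
Lemma early_potential_small (nu : {measure set (borel X) -> \bar R})
    (g : X -> R) (K : set X) (eta : R) :
  continuous g -> (forall x, potential (green p) nu x = (g x)%:E) ->
  compact K -> 0 < eta ->
  \forall n \near \oo, forall x, K x ->
    (potential (time_green p (early_times n)) nu x <= eta%:E)%E.
Proof.
move=> cg gE /compact_near_coveringP cK eta0; apply: cK => x _.
have eta20 : 0 < eta / 2 by rewrite divr_gt0.
have [N xN] : exists N,
    ((g x - eta / 2)%:E < potential (time_green p (late_times N)) nu x)%E.
  apply: contrapT => /forallNP hN.
  have := @potential_late_cvg _ _ _ p_ge0 p_continuous nu x.
  move=> /cvge_to_le hle.
  suff : ((g x)%:E <= (g x - eta / 2)%:E)%E.
    by rewrite lee_fin; lra.
  rewrite -gE; apply: hle; apply: nearW => n.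
  by rewrite leNgt; apply/negP; exact: hN.
have lscN : seq_lsc (potential (time_green p (late_times N)) nu).
  apply: (potential_time_green_seq_lsc p_ge0 p_continuous).
    exact: measurable_late_times.
 exact: late_times_gt0.
(* On this neighbourhood of [x] the late potential at [N] stays above [g x - eta / 2] and [g] stays
   within [eta / 2] of [g x]. *)
exists ([set y | (g x - eta / 2)%:E <
                 potential (time_green p (late_times N)) nu y]%E `&`
        [set y | `|g x - g y| < eta / 2], [set n | (N <= n)%N]).
  split => /=; last by exists N.
  apply: filterI.
    by apply: open_nbhs_nbhs; split => //; exact: seq_lsc_open.
  exact: (@cvgr_dist_lt _ _ _ _ _ _ _ (cg x)).
move=> [y n] /= [[yN gxy] Nn].
have yn : ((g x - eta / 2)%:E < potential (time_green p (late_times n)) nu y)%E.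
  apply: (lt_le_trans yN); apply: ge0_le_integral => //.
  - by move=> z _; apply: time_green_ge0 => //; exact: late_times_gt0.
  - by apply: time_green_measurable => //; exact: measurable_late_times.
  - by apply: time_green_measurable => //; exact: measurable_late_times.
  - move=> z _; apply: ge0_subset_integral => //.
    + exact: measurable_late_times.
    + exact: measurable_late_times.
    + by apply: kernel_measurable_time => //; exact: measurable_late_times.
    + move=> t /late_times_gt0 /=; rewrite in_itv /= andbT => t0.
      by rewrite lee_fin p_ge0.
    + exact/subsetPset/late_times_homo.
have := potential_split p_ge0 p_continuous nu n y; rewrite gE.
have : (0 <= potential (time_green p (early_times n)) nu y)%E.
  by apply: integral_ge0 => z _; apply: time_green_ge0 => //;
    exact: early_times_gt0.
(* The two parts sum to the real number [g y], so both are finite, and the early one is below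
   [g y - g x + eta / 2], hence below [eta]. *)
move: yn; case: (potential (time_green p (late_times n)) nu y) => [b| |] //.
  case: (potential (time_green p (early_times n)) nu y) => [a| |] //.
  rewrite -EFinD !lee_fin lte_fin => hb _ [hg].
  move: gxy; rewrite ltr_norml => /andP[]; lra.
by case: (potential (time_green p (early_times n)) nu y).
Qed.

(** * From the lower kernel bound to measures of balls *)

Context (alpha beta : R) (Phi1 : R -> R).
Context (beta_gt0 : 0 < beta) (alpha_gt0 : 0 < alpha).
Context (Phi1_decr : forall s u, 0 <= s -> s <= u -> Phi1 u <= Phi1 s).
Context (Phi1_1 : 0 < Phi1 1).
Context (B_lower : forall x y t, 0 < t ->
  t `^ (- (alpha / beta)) * Phi1 (mdist x y * t `^ (- beta^-1)) <= p t x y).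

Definition ball_const : R := 2 `^ (- (alpha / beta)) * Phi1 1.

Lemma ball_const_gt0 : 0 < ball_const.
Proof. by rewrite mulr_gt0 // powR_gt0. Qed.

Lemma kernel_ge (x y : X) (r t : R) : 0 < r -> mdist x y < r ->
  r `^ beta <= t <= 2 * r `^ beta -> ball_const * r `^ (- alpha) <= p t x y.
Proof.
move=> r0 xyr /andP[rt tr].
have rb0 : 0 < r `^ beta by exact: powR_gt0.
have t0 : 0 < t by exact: lt_le_trans rt.
apply: le_trans (B_lower x y t0).
have -> : ball_const * r `^ (- alpha) =
  (2 * r `^ beta) `^ (- (alpha / beta)) * Phi1 1.
  rewrite powRM ?ltW // -powRrM.
  have -> : beta * - (alpha / beta) = - alpha.
    by rewrite mulrN mulrCA divff ?gt_eqF// mulr1.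
  by rewrite /ball_const mulrAC.
have rbK : (r `^ beta) `^ beta^-1 = r.
  by rewrite -powRrM divff ?gt_eqF// powRr1 ?ltW.
apply: ler_pM; [exact: powR_ge0|exact: ltW| |].
  rewrite !powRN lef_pV2 ?posrE ?powR_gt0// ?mulr_gt0//.
  by apply: ge0_ler_powR; rewrite ?nnegrE ?divr_ge0// ltW// ?mulr_gt0.
apply: Phi1_decr; first by rewrite mulr_ge0 ?mdist_ge0 ?powR_ge0.
rewrite powRN ler_pdivrMr ?powR_gt0// mul1r (le_trans (ltW xyr))//.
rewrite -[leLHS]rbK; apply: ge0_ler_powR => //.
- by rewrite invr_ge0 ltW.
- by rewrite nnegrE ltW.
- by rewrite nnegrE ltW.
Qed.

(** The time window has length [r]^ beta[, and on it the kernel is at least]ball_const * r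
    [^ (- alpha)]. *)
Lemma time_green_ge (I : set R) (x y : X) (r : R) :
  measurable I -> I `<=` `]0, +oo[ -> 0 < r ->
  `[r `^ beta, 2 * r `^ beta] `<=` I -> mdist x y < r ->
  ((ball_const / r `^ (alpha - beta))%:E <= time_green p I x y)%E.
Proof.
move=> mI I0 r0 rI xyr.
have rb0 : 0 < r `^ beta by exact: powR_gt0.
have I_gt0 t : I t -> 0 < t by move=> /I0 /=; rewrite in_itv /= andbT.
pose J : set R := [set` `[r `^ beta, 2 * r `^ beta]].
have mJ : measurable J by exact: measurable_itv.
apply: (@le_trans _ _ (time_green p J x y)); last first.
  apply: ge0_subset_integral => //.
  - exact: kernel_measurable_time.
  - by move=> t /I_gt0 t0; rewrite lee_fin p_ge0.
apply: (@le_trans _ _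
    (\int[lebesgue_measure]_(t in J) cst (ball_const * r `^ (- alpha))%:E t)%E).
  rewrite integral_cst //= /J lebesgue_measure_itv /= lte_fin.
  rewrite ltr_pMl // ltr1n -EFinD -EFinM lee_fin.
  have -> : 2 * r `^ beta - r `^ beta = r `^ beta by lra.
  rewrite -powRN opprB addrC powRD; last by rewrite (gt_eqF r0) implybT.
  by rewrite mulrA.
apply: ge0_le_integral => //.
- by move=> t _; rewrite lee_fin mulr_ge0 ?powR_ge0 ?ltW ?ball_const_gt0.
- by apply: kernel_measurable_time => // t /rI /I0.
- by move=> t; rewrite /J /= in_itv /= => tJ; rewrite lee_fin;
    exact: kernel_ge tJ.
Qed.

(** A Chebyshev argument: on the ball the restricted Green function with pole [x] is bounded below
    by a constant. *)
Lemma measure_ball_le (nu : {measure set (borel X) -> \bar R}) (I : set R)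
    (x : X) (r k : R) :
  measurable I -> I `<=` `]0, +oo[ -> 0 < r ->
  `[r `^ beta, 2 * r `^ beta] `<=` I ->
  (potential (time_green p I) nu x <= k%:E)%E ->
  (nu (ball x r) <= (k / ball_const * r `^ (alpha - beta))%:E)%E.
Proof.
move=> mI I0 r0 rI hk.
have mB := measurable_metric_ball x r.
have cr0 : 0 < ball_const / r `^ (alpha - beta).
  by rewrite divr_gt0 ?powR_gt0 ?ball_const_gt0.
have : ((ball_const / r `^ (alpha - beta))%:E * nu (ball x r) <= k%:E)%E.
  apply: le_trans hk; rewrite -integral_cst //.
  apply: (@le_trans _ _ (\int[nu]_(y in ball x r) time_green p I x y)%E).
    apply: ge0_le_integral => //.
    - by move=> y _; rewrite lee_fin ltW.
    - apply: measurable_funTS; exact: time_green_measurable.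
    - by move=> y; rewrite ballEmdist /= => xyr; exact: time_green_ge.
  apply: ge0_subset_integral => //.
  - exact: time_green_measurable.
  - by move=> y _; exact: time_green_ge0.
by rewrite -lee_pdivlMl // -EFinM invf_div mulrC mulrA mulrAC.
Qed.

End potential_continuity.

(** * Criteria for null sets *)

Section null_sets.
Context {R : realType} {X : metricPType R}.

Lemma le_harmonic_eq0 (x : \bar R) (k : R) : (0 <= x)%E ->
  (forall n, (x <= (k * n.+1%:R^-1)%:E)%E) -> x = 0%E.
Proof.
move=> x0 hx; apply/eqP; rewrite eq_le x0 andbT.
have h : (k * n.+1%:R^-1)%:E @[n --> \oo] --> 0%:E.
  apply: cvg_EFin; first exact: nearW.
  rewrite -(mulr0 k); apply: cvgM; first exact: cvg_cst.
  exact: cvg_harmonic.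
by apply: (cvge_ge _ h); exact: nearW.
Qed.

Lemma measure_null_balls (nu : {measure set (borel X) -> \bar R})
    (S : set (borel X)) (x : X) : measurable S ->
  (forall n, nu (S `&` ball x n%:R) = 0%E) -> nu S = 0%E.
Proof.
move=> mS hS; apply/eqP; rewrite eq_le measure_ge0 andbT.
apply: (@le_trans _ _ (\sum_(0 <= n <oo) nu (S `&` ball x n%:R))%E).
  apply: measure_sigma_subadditive => //.
    by move=> n; apply: measurableI => //; exact: measurable_metric_ball.
  by rewrite -setI_bigcupr bigcup_metric_ball setIT.
by rewrite eseries0.
Qed.

Lemma measure_setT_eq0 (nu : {measure set (borel X) -> \bar R})
    (S : set (borel X)) : measurable S ->
  nu S = 0%E -> nu (~` S) = 0%E -> nu setT = 0%E.
Proof.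
move=> mS S0 CS0; rewrite -(setvU S) measureU ?setICl//;
  last exact: measurableC.
by rewrite [X in (X + _)%E]CS0 [X in (_ + X)%E]S0 adde0.
Qed.

End null_sets.

(** * Semipolar and polar hulls *)

Theorem theorem7p10 (R : realType) (X : metricPType R)
  (X_separable : separable_space X)
  (ball_precompact : forall (x : X) (r : R), precompact (ball x r))
  (mu : {measure set (borel X) -> \bar R})
  (mu_radon : radon mu) (mu_full : full_support mu)
  (p : R -> X -> X -> R)
  (p_ge0 : forall t x y, 0 < t -> 0 <= p t x y)
  (p_continuous : {within [set z : X * X * R | 0 < z.2],
     continuous (fun z : X * X * R => p z.2 z.1.1 z.1.2)})
  (CK : forall s t x y, 0 < s -> 0 < t ->
     (p (s + t) x y)%:E = (\int[mu]_z (p s x z * p t z y)%:E)%E)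
  (E : forall x,
     ereal_sup [set (\int[mu]_y (p t x y)%:E)%E | t in [set t : R | (0 < t)%R]]
     = 1%E)
  (alpha beta : R) (alpha_gt0 : 0 < alpha) (beta_gt0 : 0 < beta)
  (Phi1 Phi2 : R -> R)
  (Phi1_ge0 : forall s, 0 <= s -> 0 <= Phi1 s)
  (Phi2_ge0 : forall s, 0 <= s -> 0 <= Phi2 s)
  (Phi1_decr : forall s u, 0 <= s -> s <= u -> Phi1 u <= Phi1 s)
  (Phi2_decr : forall s u, 0 <= s -> s <= u -> Phi2 u <= Phi2 s)
  (Phi1_1 : 0 < Phi1 1)
  (Phi2_int : (\int[lebesgue_measure]_(s in `]0%R, +oo[)
                 (s `^ (alpha - 1) * Phi2 s)%:E < +oo)%E)
  (B_lower : forall x y t, 0 < t ->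
     t `^ (- (alpha / beta)) * Phi1 (mdist x y * t `^ (- beta^-1)) <= p t x y)
  (B_upper : forall x y t, 0 < t ->
     p t x y <= t `^ (- (alpha / beta)) * Phi2 (mdist x y * t `^ (- beta^-1)))
  (beta_lt_alpha : beta < alpha)
  (A : set X) :
  ((hausdorff_ball_measure (alpha - beta) A < +oo)%E ->
     exists2 S : set X, A `<=` S & semipolar (green p) S) /\
  (hausdorff_ball_measure (alpha - beta) A = 0%E ->
     exists2 S : set X, A `<=` S & polar (green p) S).
Proof.
have s_const : 0 < ball_const alpha beta Phi1 by exact: ball_const_gt0.
set c0 := ball_const alpha beta Phi1 in s_const.
have ball_le := measure_ball_le p_ge0 p_continuous beta_gt0 alpha_gt0
  Phi1_decr Phi1_1 B_lower.
pose x0 : X := point.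
split=> [Afin|A0].
- have [M AM] : exists M :
    R, (hausdorff_ball_measure (alpha - beta) A < M%:E)%E.
    move: Afin; case: (hausdorff_ball_measure (alpha - beta) A) => [r| |] // _.
      by exists (r + 1); rewrite lte_fin ltrDl.
    by exists 0; rewrite ltNyr.
  have [S AS [mS cover]] := hausdorff_hull (fun=> AM).
  exists S => //; split => // -[nu [_ /eqP nu0 nuS [g cg gE]]]; apply: nu0.
  (* Since [nu] vanishes off [S], it suffices that [nu] vanishes on [S] inside each ball about [x0];
     this reduces matters to a compact set of centres. *)
  apply: (measure_setT_eq0 mS) => //;
    apply: (measure_null_balls (x := x0)) => // N.
  apply: (@le_harmonic_eq0 _ _ (M / c0)) => // m.
  have eta0 : (0 : R) < m.+1%:R^-1 by rewrite invr_gt0.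
  (* The radii will be less than [1], so every cover ball that meets [ball x0 N%:R] has its centre
     in [K]. *)
  pose K := closure (ball x0 (N%:R + 1)).
  have cK : compact K by rewrite -precompactE; exact: ball_precompact.
  have [n0 _ /(_ n0 (leqnn n0)) small] :=
    early_potential_small p_ge0 p_continuous cg gE cK eta0.
  pose delta : R := (2 * n0.+1%:R)^-1 `^ beta^-1.
  have delta0 : 0 < delta by rewrite powR_gt0 // invr_gt0 mulr_gt0.
  have deltaK : delta `^ beta = (2 * n0.+1%:R)^-1.
    by rewrite -powRrM mulVf ?gt_eqF// powRr1 // invr_ge0 mulr_ge0.
  have [j _ /(_ j (leqnn j)) /= jdelta] :=
    near_infty_natSinv_lt (PosNum delta0).
  have [x [rho [rho_bd Scov sumM]]] := cover j.
  apply: (@le_trans _ _ ((m.+1%:R^-1 / c0)%:E *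
      \sum_(0 <= i <oo) (rho i `^ (alpha - beta))%:E)%E); last first.
    rewrite (_ : M / c0 / m.+1%:R = m.+1%:R^-1 / c0 * M); last first.
      by rewrite mulrC mulrCA mulrC.
    by rewrite [leRHS]EFinM lee_wpmul2l ?lee_fin ?divr_ge0 // ltW.
  apply: (cover_measure_le mS _ _ Scov).
  + exact: measurable_metric_ball.
  + by rewrite divr_ge0 ?ltW.
  move=> i; have /andP[rho0 rhoj] := rho_bd i.
  (* For a centre in [K] the small early potential bounds the ball; for any other centre the ball
     misses [ball x0 N%:R]. *)
  have [Kx|nKx] := pselect (K (x i)).
    apply: le_trans (le_measure nu _ _ (@subIsetl _ _ _)) _.
    - rewrite inE; apply: measurableI; exact: measurable_metric_ball.
    - by rewrite inE; exact: measurable_metric_ball.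
    apply: (ball_le nu (early_times n0)) => //.
    + exact: measurable_early_times.
    + have rb0 : 0 < rho i `^ beta by exact: powR_gt0.
      have rb : 2 * rho i `^ beta < n0.+1%:R^-1.
        rewrite -ltr_pdivlMl // -invfM -deltaK; apply: gt0_ltr_powR => //.
        * by rewrite nnegrE ltW.
        * by rewrite nnegrE ltW.
        * exact: lt_trans jdelta.
      move=> t; rewrite /early_times /= !in_itv /= => /andP[t1 t2].
      by rewrite (lt_le_trans rb0 t1) (le_lt_trans t2 rb).
    + exact: small.
  rewrite [X in nu X](_ : _ = set0).
    by rewrite measure0 lee_fin mulr_ge0 ?powR_ge0 ?divr_ge0 ?ltW.
  apply/seteqP; split => // y []; rewrite !ballEmdist /= => xy x0y.
  apply: nKx; apply: subset_closure; rewrite ballEmdist /=.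
  apply: (le_lt_trans (metric_triangle x0 y (x i))).
  apply: ltrD => //; rewrite metric_sym; apply: (lt_trans xy).
  by apply: (lt_le_trans rhoj); rewrite invf_le1 // ler1n.
- have AM n : (hausdorff_ball_measure (alpha - beta) A < (n.+1%:R^-1)%:E)%E.
    by rewrite A0 lte_fin invr_gt0.
  have [S AS [mS cover]] := hausdorff_hull AM.
  exists S => //; split => // -[nu [_ /eqP nu0 nuS [c cE]]]; apply: nu0.
  (* The bound [c] dominates a nonnegative potential at [x0]; its sign is needed to multiply the sum
     over the cover. *)
  have c_ge0 : 0 <= c.
    rewrite -lee_fin; apply: le_trans (cE x0); apply: integral_ge0 => y _.
    by apply: integral_ge0 => t; rewrite /= in_itv /= andbT => t0;
      rewrite lee_fin p_ge0.
  apply: (measure_setT_eq0 mS) => //.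
  apply: (@le_harmonic_eq0 _ _ (c / c0)) => // n.
  have [x [rho [rho_bd Scov sumn]]] := cover n.
  apply: (@le_trans _ _ ((c / c0)%:E *
      \sum_(0 <= i <oo) (rho i `^ (alpha - beta))%:E)%E); last first.
    by rewrite [leRHS]EFinM lee_wpmul2l ?lee_fin ?divr_ge0 // ltW.
  rewrite -[S]setIT; apply: (cover_measure_le mS _ _ Scov) => //;
    first by rewrite divr_ge0 // ltW.
  move=> i; have /andP[rho0 _] := rho_bd i; rewrite setIT.
  (* A bounded full potential allows all positive times, so every radius is admissible and no
     localisation is required. *)
  apply: (ball_le nu `]0, +oo[%classic) => //.
  move=> t; rewrite /= !in_itv /= andbT => /andP[rt _].
  by apply: lt_le_trans rt; exact: powR_gt0.
Qed.
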